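(* Let $$A_n=\sum_{k=0}^{n}\binom{n}{k}^2\binom{n+k}{k}^2,\qquad B_n=\sum_{k=0}^{n}\binom{n}{k}^2\binom{n+k}{k}^2\left\{\sum_{m=1}^{n}\frac{1}{m^3}+\sum_{m=1}^{k}\frac{(-1)^{m-1}}{2m^3\binom{n}{m}\binom{n+m}{m}}\right\}.$$ Then each of the three sequences $x_{n-1}=A_nA_{n-1}$, $y_{n-1}=B_nB_{n-1}$, $z_{n-1}=A_nB_{n-1}+A_{n-1}B_n$ ($n\ge1$) is a solution of the four-term recurrence relation $$\begin{aligned} &(n+3)^3(n+2)^6(2n+1)(17n^2+17n+5)\,z_{n+2}\\ &-(2n+1)(17n^2+17n+5)(1155n^6+13860n^5+68535n^4+178680n^3+259059n^2+198156n+62531)(n+2)^3\,z_{n+1}\\ &+(2n+5)(17n^2+85n+107)(1155n^6+6930n^5+16560n^4+20040n^3+12954n^2+4308n+584)(n+1)^3\,z_n\\ &-(n+1)^6n^3(2n+5)(17n^2+85n+107)\,z_{n-1}=0,\qquad n\ge1, \end{aligned}$$ and these three sequences form a basis of its solution space.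
   Context: $A_n$ and $B_n$ are the Apéry sequences; they are the solutions of $(n+1)^3y_{n+1}+n^3y_{n-1}=(34n^3+51n^2+27n+5)y_n$ ($n\ge1$) with $A_0=1,A_1=5$ and $B_0=0,B_1=6$. *)

(* Defs.v *)
From mathcomp Require Import all_boot all_order all_algebra.

Set Implicit Arguments.
Unset Strict Implicit.
Unset Printing Implicit Defensive.

Import Order.TTheory GRing.Theory Num.Theory.
Local Open Scope ring_scope.

Section Apery.
Variable F : numFieldType.

Definition apery_weight (n k : nat) : F :=
  'C(n, k)%:R ^+ 2 * 'C((n + k)%N, k)%:R ^+ 2.

Definition apery_A (n : nat) : F := \sum_(0 <= k < n.+1) apery_weight n k.

Definition apery_B (n : nat) : F :=
  \sum_(0 <= k < n.+1) apery_weight n k *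
    (\sum_(1 <= m < n.+1) 1 / m%:R ^+ 3
     + \sum_(1 <= m < k.+1)
         (-1) ^+ m.-1 /
         (2 * m%:R ^+ 3 * 'C(n, m)%:R * 'C((n + m)%N, m)%:R)).

(* The term of index n - 1, for n >= 1, is the product of the terms of indices
   n and n - 1; the three sequences are therefore indexed from 0. *)
Definition seq_x (j : nat) : F := apery_A j.+1 * apery_A j.
Definition seq_y (j : nat) : F := apery_B j.+1 * apery_B j.
Definition seq_z (j : nat) : F :=
  apery_A j.+1 * apery_B j + apery_A j * apery_B j.+1.

(* The index of u is a natural number, whereas the polynomial coefficients are
   evaluated at the image x of n in F.  The large coefficients are written with
   an explicit %:R over a nat literal, which Rocq keeps in decimal form; a plain
   ring_scope literal would be expanded to a unary nat. *)
Definition is_solution (u : nat -> F) : Prop :=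
  forall n : nat, (1 <= n)%N -> let x : F := n%:R in
      (x + 3) ^+ 3 * (x + 2) ^+ 6 * (2 * x + 1)
        * (17 * x ^+ 2 + 17 * x + 5) * u n.+2
    - (2 * x + 1) * (17 * x ^+ 2 + 17 * x + 5)
        * (1155 * x ^+ 6 + 13860%:R * x ^+ 5 + 68535%:R * x ^+ 4 + 178680%:R * x ^+ 3
           + 259059%:R * x ^+ 2 + 198156%:R * x + 62531%:R)
        * (x + 2) ^+ 3 * u n.+1
    + (2 * x + 5) * (17 * x ^+ 2 + 85 * x + 107)
        * (1155 * x ^+ 6 + 6930%:R * x ^+ 5 + 16560%:R * x ^+ 4 + 20040%:R * x ^+ 3
           + 12954%:R * x ^+ 2 + 4308 * x + 584)
        * (x + 1) ^+ 3 * u n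
    - (x + 1) ^+ 6 * x ^+ 3 * (2 * x + 5)
        * (17 * x ^+ 2 + 85 * x + 107) * u n.-1
    = 0.

Definition lin_comb (d : nat) (c : 'I_d -> F) (b : 'I_d -> nat -> F) :
    nat -> F :=
  fun j => \sum_(i < d) c i * b i j.

Definition lin_indep (d : nat) (b : 'I_d -> nat -> F) : Prop :=
  forall c : 'I_d -> F, lin_comb c b =1 (fun=> 0) -> forall i, c i = 0.

(* b is a basis of the space of sequences {u | S u}. *)
Definition is_basis (S : (nat -> F) -> Prop) (d : nat) (b : 'I_d -> nat -> F) :
    Prop :=
  [/\ forall i, S (b i),
      lin_indep b
    & forall u, S u -> exists c : 'I_d -> F, u =1 lin_comb c b].

Definition seq_xyz : 'I_3 -> nat -> F :=
  tnth [tuple seq_x; seq_y; seq_z].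

End Apery.

(* Main.v *)
(* Both Apery sequences satisfy the second-order recurrence by creative
   telescoping: the operator applied to the summands w(n, k), resp.
   w(n, k) c(n, k), is a difference in k of an explicit certificate.  The
   symmetric products of two solutions of a second-order recurrence span a
   space of dimension 3 over the rational functions, and eliminating among four
   consecutive ones gives the four-term recurrence.  Its leading coefficient
   does not vanish, so a solution is determined by its first three terms, and
   the combination of the three sequences with given first three terms is
   explicit. *)
Require Import Defs.
From mathcomp Require Import all_boot all_order all_algebra.
From mathcomp Require Import ring.

Set Implicit Arguments.
Unset Strict Implicit.
Unset Printing Implicit Defensive.

Import Order.TTheory GRing.Theory Num.Theory.
Local Open Scope ring_scope.

Section AperyRecurrence.
Variable F : numFieldType.
Implicit Types (n k m : nat) (f g u : nat -> F).

Local Notation w := (apery_weight F).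
Local Notation bin n k := ('C(n, k)%:R : F).

Definition apery_poly (x : F) : F := (2 * x + 1) * (17 * x ^+ 2 + 17 * x + 5).

Definition apery_op f n : F :=
  (n%:R + 2) ^+ 3 * f n.+2 - apery_poly (n%:R + 1) * f n.+1
  + (n%:R + 1) ^+ 3 * f n.

Lemma natS_neq0 n : (n%:R + 1 : F) != 0.
Proof. by rewrite natr1 pnatr_eq0. Qed.

(* Folds a denominator, a sum of casts and numerals, into a single cast. *)
Let natr_neq0 :=
  (=^~ @natrD F, @natr1 F, @pnatr_eq0 F, addn1, addn2, addnS).

(** * Shifts of binomial coefficients *)

(** Going down from [n.+1] divides only by [n + 1], so no bound on [k] is needed: the factor
    [n + 1 - k] vanishes at [k = n + 1]. *)
Lemma bin_downl n k :
  bin n k = (n%:R + 1 - k%:R) / (n%:R + 1) * bin n.+1 k.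
Proof.
have n1 := natS_neq0 n.
apply: (mulfI n1); rewrite mulrA mulrCA divff // mulr1.
have [le_kn|lt_nk] := leqP k n.+1; last first.
  by rewrite !bin_small ?mulr0 //; apply: ltnW.
by rewrite natr1 -natrB // -!natrM -mul_bin_down.
Qed.

Lemma bin_down_diag n k :
  bin n k = (k%:R + 1) / (n%:R + 1) * bin n.+1 k.+1.
Proof.
have n1 := natS_neq0 n.
apply: (mulfI n1); rewrite mulrA mulrCA divff // mulr1.
by rewrite !natr1 -!natrM -mul_bin_diag.
Qed.

Lemma bin_up_diag n k :
  bin n.+1 k.+1 = (n%:R + 1) / (k%:R + 1) * bin n k.
Proof.
rewrite [in RHS]bin_down_diag.
by field; rewrite !natS_neq0.
Qed.

Lemma bin_upr n k :
  bin n k.+1 = (n%:R - k%:R) / (k%:R + 1) * bin n k.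
Proof.
rewrite bin_downl bin_up_diag -natr1.
by field; rewrite !natS_neq0.
Qed.

Lemma bin_add_upl n k :
  bin (n.+1 + k) k = (n%:R + k%:R + 1) / (n%:R + 1) * bin (n + k) k.
Proof.
rewrite [bin (n + k) k]bin_downl addSn natrD.
by field; rewrite natS_neq0 -natrD natS_neq0.
Qed.

Lemma bin_add_up_diag n k :
  bin (n + k.+1) k.+1 = (n%:R + k%:R + 1) / (k%:R + 1) * bin (n + k) k.
Proof. by rewrite addnS bin_up_diag natrD. Qed.

(** * Creative telescoping for [apery_A] *)

Lemma apery_weight_small n k : (n < k)%N -> w n k = 0.
Proof. by move=> lt_nk; rewrite /apery_weight bin_small // expr0n mul0r. Qed.

(* Van der Poorten's certificate, with the central index n shifted to n + 1. *)
Definition wz_cert n k : F :=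
  4 * (2 * n%:R + 3) * (k%:R * (2 * k%:R + 1) - (2 * n%:R + 3) ^+ 2) * w n.+1 k.

Lemma wz_weight0 n : apery_op (w^~ 0) n = wz_cert n 0.
Proof.
rewrite /apery_op /wz_cert /apery_poly /apery_weight !bin0.
by ring.
Qed.

Lemma wz_weightS n k :
  apery_op (w^~ k.+1) n = wz_cert n k.+1 - wz_cert n k.
Proof.
rewrite /apery_op /wz_cert /apery_poly /apery_weight.
(* Everything is reduced to [bin n.+2 k.+1] and [bin (n + k) k], with denominators that never
   vanish. *)
rewrite [bin n _]bin_downl [bin n.+1 k]bin_down_diag [bin n.+1 k.+1]bin_downl.
rewrite !bin_add_up_diag !bin_add_upl -(natr1 n) -(natr1 k).
by field; rewrite !natr_neq0.
Qed.

Lemma sum_widen (h : nat -> F) n p : (n <= p)%N ->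
  (forall k, (n < k)%N -> h k = 0) ->
  \sum_(0 <= k < n.+1) h k = \sum_(0 <= k < p.+1) h k.
Proof.
move=> le_np h0; rewrite (@big_cat_nat _ _ _ n.+1 0 p.+1) //=.
rewrite [X in _ + X]big1_seq ?addr0 // => k /andP[_].
by rewrite mem_index_iota => /andP[/h0].
Qed.

Lemma apery_op_sum (h : nat -> nat -> F) n :
  (forall p k, (p < k)%N -> h p k = 0) ->
  apery_op (fun p => \sum_(0 <= k < p.+1) h p k) n
  = \sum_(0 <= k < n.+3) apery_op (h^~ k) n.
Proof.
move=> h0; rewrite /apery_op.
have le2 : (n <= n.+2)%N by rewrite -addn2 leq_addr.
rewrite (sum_widen le2 (h0 n)) (sum_widen (leqnSn n.+1) (h0 n.+1)).
by rewrite !big_distrr /= -sumrB -big_split.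
Qed.

Lemma apery_A_rec n : apery_op (apery_A F) n = 0.
Proof.
rewrite (apery_op_sum (h := w)); last exact: apery_weight_small.
(* At [k = n + 2] the certificate contains [w n.+1 n.+2 = 0]. *)
suff -> k : \sum_(0 <= i < k.+1) apery_op (w^~ i) n = wz_cert n k.
  by rewrite /wz_cert apery_weight_small ?mulr0.
elim: k => [|k IHk]; first by rewrite big_nat1 wz_weight0.
by rewrite big_nat_recr //= IHk wz_weightS addrC subrK.
Qed.

(** * Creative telescoping for [apery_B] *)

Definition apery_c n k : F :=
  \sum_(1 <= m < n.+1) 1 / m%:R ^+ 3
  + \sum_(1 <= m < k.+1)
      (-1) ^+ m.-1 / (2 * m%:R ^+ 3 * 'C(n, m)%:R * 'C((n + m)%N, m)%:R).

Lemma apery_cS n k : apery_c n k.+1 = apery_c n k +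
  (-1) ^+ k / (2 * (k%:R + 1) ^+ 3 * bin n k.+1 * bin (n + k.+1) k.+1).
Proof.
by rewrite /apery_c (@big_nat_recr _ _ _ k.+1 1) //= addrA -(natr1 k).
Qed.

Lemma bin_neq0 n k : (k <= n)%N -> bin n k != 0.
Proof. by move=> le_kn; rewrite pnatr_eq0 -lt0n bin_gt0. Qed.

Lemma bin_add_neq0 n k : bin (n + k) k != 0.
Proof. by rewrite bin_neq0 // leq_addl. Qed.

(** The change in [n] of the [m]-th summand is a difference in [m] of the closed term on the right,
    whose value at [k = 0] is the new [1 / (n + 1) ^ 3]. *)
Lemma apery_c_up n k : (k <= n)%N ->
  apery_c n.+1 k = apery_c n k +
    (-1) ^+ k / ((n%:R + 1) ^+ 3 * bin n k * bin (n.+1 + k) k).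
Proof.
elim: k => [_|k IHk lt_kn].
  rewrite /apery_c ![\sum_(1 <= i < 1) _]big_geq // !addr0 big_nat_recr //=.
  by rewrite -natr1 !bin0 !mulr1.
rewrite !apery_cS IHk; last exact: ltnW.
have bn0 := bin_neq0 lt_kn.
have dn0 := bin_add_neq0 n k.
have nk0 : (n%:R - k%:R : F) != 0.
  by rewrite subr_eq0 eqr_nat neq_ltn lt_kn orbT.
rewrite !bin_add_up_diag [bin n.+1 k.+1]bin_up_diag bin_upr.
rewrite bin_add_upl [(-1) ^+ k.+1]exprS -(natr1 n).
have a0 := bin_neq0 (ltnW lt_kn).
by field; rewrite dn0 a0 nk0 !natr_neq0.
Qed.

(** The squared binomials of the weight absorb the denominators of [apery_c_up], and both sides
    vanish for [k > n]. *)
Lemma weight_c_down n k :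
  w n k * apery_c n k = w n k * apery_c n.+1 k
    - (-1) ^+ k * bin n k * bin (n + k) k
      / ((n%:R + 1) ^+ 2 * (n%:R + k%:R + 1)).
Proof.
have [le_kn|lt_nk] := leqP k n; last first.
  by rewrite apery_weight_small // bin_small //; ring.
rewrite apery_c_up // bin_add_upl /apery_weight.
have := bin_neq0 le_kn; have := bin_add_neq0 n k.
move: (apery_c n k) ((-1) ^+ k) => c e b0 a0.
by field; rewrite a0 b0 !natr_neq0.
Qed.

Lemma weight_c_up n k : (k <= n)%N ->
  w n.+1 k * apery_c n.+1 k = w n.+1 k * apery_c n k
    + (-1) ^+ k * bin n.+1 k * bin (n.+1 + k) k
      / ((n%:R + 1) ^+ 2 * (n%:R + 1 - k%:R)).
Proof.
move=> le_kn; have nk0 : (n%:R + 1 - k%:R : F) != 0.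
  by rewrite natr1 subr_eq0 eqr_nat neq_ltn ltnS le_kn orbT.
rewrite apery_c_up // bin_downl /apery_weight.
have := bin_neq0 (leqW le_kn); have := bin_add_neq0 n.+1 k.
move: (apery_c n k) ((-1) ^+ k) => c e b0 a0.
by field; rewrite a0 b0 nk0 !natr_neq0.
Qed.

(** Bringing every [apery_c] to the middle index [n.+1] lets the certificate of the weights apply;
    the remainder is hypergeometric. *)
Lemma apery_op_weight_c n k : (k <= n.+1)%N ->
  apery_op (fun p => w p k * apery_c p k) n =
    apery_c n.+1 k * apery_op (w^~ k) n
    + (-1) ^+ k *
      ((n%:R + 2) / (n%:R + 2 - k%:R) * bin n.+2 k * bin (n.+2 + k) k
       - (n%:R + 1) / (n%:R + k%:R + 1) * bin n k * bin (n + k) k).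
Proof.
move=> le_kn; have nk0 : (n%:R + 2 - k%:R : F) != 0.
  by rewrite -natrD addn2 subr_eq0 eqr_nat neq_ltn ltnS le_kn orbT.
rewrite /apery_op (weight_c_down n) (@weight_c_up n.+1) // -(natr1 n).
by field; rewrite nk0 !natr_neq0.
Qed.

(** As in summation by parts: the first term telescopes the weights, the second absorbs the
    variation of [apery_c] in both indices. *)
Definition wz_cert_c n k : F :=
  wz_cert n k * apery_c n.+1 k
  - (-1) ^+ k * 5 * (2 * n%:R + 3) * k%:R / ((n%:R + 1) * (n%:R + 2))
    * bin n.+1 k * bin (n.+1 + k) k.

Lemma wz_weight_c0 n :
  apery_op (fun p => w p 0 * apery_c p 0) n = wz_cert_c n 0.
Proof.
rewrite apery_op_weight_c // wz_weight0 /wz_cert_c !bin0.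
by field; rewrite !natr_neq0.
Qed.

Lemma wz_weight_cS n k : (k <= n)%N ->
  apery_op (fun p => w p k.+1 * apery_c p k.+1) n
  = wz_cert_c n k.+1 - wz_cert_c n k.
Proof.
move=> le_kn; have nk0 : (n%:R + 1 - k%:R : F) != 0.
  by rewrite natr1 subr_eq0 eqr_nat neq_ltn ltnS le_kn orbT.
rewrite apery_op_weight_c // wz_weightS /wz_cert_c apery_cS.
rewrite /wz_cert /apery_weight.
rewrite [bin n _]bin_downl !bin_add_up_diag [bin n.+2 _]bin_up_diag !bin_upr.
rewrite !bin_add_upl [(-1) ^+ k.+1]exprS -(natr1 n.+1) -(natr1 n) -(natr1 k).
have := bin_neq0 (leqW le_kn); have := bin_add_neq0 n k.
move: (apery_c n.+1 k) ((-1) ^+ k) => c e b0 a0.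
by field; rewrite a0 b0 nk0 !natr_neq0.
Qed.

(** The boundary [k = n + 2], where [n + 2 - k] is no longer invertible. Only the weight at
    [p = n.+2] survives, and it cancels the preceding partial sum. *)
Lemma wz_weight_c_last n :
  apery_op (fun p => w p n.+2 * apery_c p n.+2) n = - wz_cert_c n n.+1.
Proof.
have w0 p : (p < n.+2)%N -> w p n.+2 = 0 by exact: apery_weight_small.
have := wz_weightS n n.+1.
rewrite /wz_cert_c /apery_op {1}/wz_cert apery_cS apery_c_up //.
rewrite (w0 n.+1) // (w0 n) // !(mulr0, mul0r, subr0, addr0, sub0r) mulrA => ->.
rewrite /wz_cert /apery_weight !binn !bin_add_up_diag !bin_add_upl.
rewrite [(-1) ^+ n.+1]exprS -(natr1 n.+1) -(natr1 n).
have := bin_add_neq0 n n.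
move: (apery_c n.+1 n.+1) ((-1) ^+ n) => c e b0.
by field; rewrite b0 !natr_neq0.
Qed.

Lemma apery_B_rec n : apery_op (apery_B F) n = 0.
Proof.
rewrite (apery_op_sum (h := fun p k => w p k * apery_c p k)); last first.
  by move=> p k lt_pk; rewrite apery_weight_small ?mul0r.
rewrite big_nat_recr //= wz_weight_c_last.
suff certE k : (k <= n.+1)%N ->
    \sum_(0 <= i < k.+1) apery_op (fun p => w p i * apery_c p i) n
    = wz_cert_c n k by rewrite certE ?subrr.
elim: k => [|k IHk] le_kn; first by rewrite big_nat1 wz_weight_c0.
by rewrite big_nat_recr //= IHk ?wz_weight_cS ?(ltnW le_kn) // addrC subrK.
Qed.

(** * The four-term recurrence for products *)

(* In terms of [p x := apery_poly x], the two large coefficients are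
   [p (x + 1) * p (x + 2) - (x + 2) ^+ 6] and
   [p x * p (x + 1) - (x + 1) ^+ 6]. *)
Lemma coef_next (x : F) :
  1155 * x ^+ 6 + 13860%:R * x ^+ 5 + 68535%:R * x ^+ 4 + 178680%:R * x ^+ 3
    + 259059%:R * x ^+ 2 + 198156%:R * x + 62531%:R
  = apery_poly (x + 1) * apery_poly (x + 2) - (x + 2) ^+ 6.
Proof. by rewrite /apery_poly; ring. Qed.

Lemma coef_cur (x : F) :
  1155 * x ^+ 6 + 6930%:R * x ^+ 5 + 16560%:R * x ^+ 4 + 20040%:R * x ^+ 3
    + 12954%:R * x ^+ 2 + 4308 * x + 584
  = apery_poly x * apery_poly (x + 1) - (x + 1) ^+ 6.
Proof. by rewrite /apery_poly; ring. Qed.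

(* The mixed terms [z21 := f2 * g1 + f1 * g2], [f1 * g1] and [f2 * g2] span all
   the products; the combination below vanishes identically in them. *)
Lemma symmetric_product_rec (a b c d p1 p2 p3 : F)
    (f0 f1 f2 f3 f4 g0 g1 g2 g3 g4 : F) :
    a * f2 = p1 * f1 - c * f0 -> a * g2 = p1 * g1 - c * g0 ->
    b * f3 = p2 * f2 - a * f1 -> b * g3 = p2 * g2 - a * g1 ->
    d * f4 = p3 * f3 - b * f2 -> d * g4 = p3 * g3 - b * g2 ->
  p1 * b ^+ 2 * (d * (f4 * g3 + f3 * g4))
  - p1 * (p2 * p3 - b ^+ 2) * (b * (f3 * g2 + f2 * g3))
  + p3 * (p1 * p2 - a ^+ 2) * (a * (f2 * g1 + f1 * g2))
  - p3 * a ^+ 2 * (c * (f1 * g0 + f0 * g1)) = 0.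
Proof.
move=> f2E g2E f3E g3E f4E g4E.
have -> : d * (f4 * g3 + f3 * g4)
    = 2 * p3 * (f3 * g3) - b * (f3 * g2 + f2 * g3).
  by rewrite mulrDr mulrA f4E mulrCA g4E; ring.
have -> : c * (f1 * g0 + f0 * g1)
    = 2 * p1 * (f1 * g1) - a * (f2 * g1 + f1 * g2).
  have f0E : c * f0 = p1 * f1 - a * f2 by rewrite f2E; ring.
  have g0E : c * g0 = p1 * g1 - a * g2 by rewrite g2E; ring.
  by rewrite mulrDr mulrCA g0E mulrA f0E; ring.
have b32 : b * (f3 * g2 + f2 * g3)
    = 2 * p2 * (f2 * g2) - a * (f2 * g1 + f1 * g2).
  by rewrite mulrDr mulrA f3E mulrCA g3E; ring.
have b33 : b ^+ 2 * (f3 * g3)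
    = p2 ^+ 2 * (f2 * g2) - a * p2 * (f2 * g1 + f1 * g2) + a ^+ 2 * (f1 * g1).
  by rewrite expr2 mulrACA f3E g3E; ring.
rewrite b32 [2 * p3 * _]mulrC.
have -> : p1 * b ^+ 2 * (f3 * g3 * (2 * p3)
      - (2 * p2 * (f2 * g2) - a * (f2 * g1 + f1 * g2)))
    = 2 * p1 * p3 * (b ^+ 2 * (f3 * g3))
      - p1 * b ^+ 2 * (2 * p2 * (f2 * g2) - a * (f2 * g1 + f1 * g2)) by ring.
by rewrite b33; ring.
Qed.

Lemma apery_op_eq0 f n (x : F) : x = n%:R + 1 -> apery_op f n = 0 ->
  (x + 1) ^+ 3 * f n.+2 = apery_poly x * f n.+1 - x ^+ 3 * f n.
Proof.
move=> -> fn; apply/eqP; rewrite -subr_eq0 -fn /apery_op; apply/eqP; ring.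
Qed.

(** Covers all three sequences, since [f = g] gives twice [f j.+1 * f j]. *)
Lemma apery_prod_solution f g :
    (forall n, apery_op f n = 0) -> (forall n, apery_op g n = 0) ->
  is_solution (fun j => f j.+1 * g j + f j * g j.+1).
Proof.
move=> fP gP [//|n] _; cbv zeta; rewrite coef_next coef_cur -pred_Sn.
have xE : n.+1%:R = n%:R + 1 :> F by rewrite natr1.
move: n.+1%:R xE => x xE.
have x1E : x + 1 = n.+1%:R + 1 by rewrite xE natr1.
have x2E : x + 1 + 1 = n.+2%:R + 1 by rewrite x1E natr1.
(* Here [c], [a], [b], [d] are the cubes of [x], [x + 1], [x + 2], [x + 3], and [p1], [p2], [p3] are
   [apery_poly] at the first three. *)
have := symmetric_product_rec (apery_op_eq0 xE (fP n)) (apery_op_eq0 xE (gP n))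
  (apery_op_eq0 x1E (fP n.+1)) (apery_op_eq0 x1E (gP n.+1))
  (apery_op_eq0 x2E (fP n.+2)) (apery_op_eq0 x2E (gP n.+2)).
rewrite {xE x1E x2E}.
move: (f n) (f n.+1) (f n.+2) (f n.+3) (f n.+4) => f0 f1 f2 f3 f4.
move: (g n) (g n.+1) (g n.+2) (g n.+3) (g n.+4) => g0 g1 g2 g3 g4.
move=> E; rewrite -[RHS]E.
rewrite (_ : x + 1 + 1 = x + 2); last by ring.
rewrite (_ : x + 2 + 1 = x + 3); last by ring.
have p3E : (2 * x + 5) * (17 * x ^+ 2 + 85 * x + 107) = apery_poly (x + 2).
  by rewrite /apery_poly; ring.
rewrite -[_ * (2 * x + 1) * _]mulrA -[_ * (2 * x + 5) * _]mulrA p3E.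
rewrite -/(apery_poly x).
move: (apery_poly x) (apery_poly (x + 1)) (apery_poly (x + 2)) => p1 p2 p3.
by ring.
Qed.

(** * Linearity and uniqueness of solutions *)

Lemma is_solution_lin a b c u v t :
    is_solution u -> is_solution v -> is_solution t ->
  is_solution (fun j => a * u j + b * v j + c * t j).
Proof.
move=> Su Sv St n n0; have := St n n0; have := Sv n n0; have := Su n n0.
cbv zeta.
have rec_lin (k3 k2 k1 k0 u3 u2 u1 u0 v3 v2 v1 v0 t3 t2 t1 t0 : F) :
    k3 * u3 - k2 * u2 + k1 * u1 - k0 * u0 = 0 ->
    k3 * v3 - k2 * v2 + k1 * v1 - k0 * v0 = 0 ->
    k3 * t3 - k2 * t2 + k1 * t1 - k0 * t0 = 0 ->
  k3 * (a * u3 + b * v3 + c * t3) - k2 * (a * u2 + b * v2 + c * t2)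
  + k1 * (a * u1 + b * v1 + c * t1) - k0 * (a * u0 + b * v0 + c * t0) = 0.
  move=> uE vE tE; transitivity (a * 0 + b * 0 + c * 0 : F); last by ring.
  by rewrite -[in a * 0]uE -[in b * 0]vE -[in c * 0]tE; ring.
exact: rec_lin.
Qed.

Lemma eq_solution u v : u =1 v -> is_solution u -> is_solution v.
Proof. by move=> uv Su n n0; have := Su n n0; rewrite !uv. Qed.

Lemma solution_determined u v : is_solution u -> is_solution v ->
  u 0 = v 0 -> u 1 = v 1 -> u 2 = v 2 -> u =1 v.
Proof.
move=> Su Sv e0 e1 e2 j.
suff [] : [/\ u j = v j, u j.+1 = v j.+1 & u j.+2 = v j.+2] by [].
elim: j => [//|j [uv0 uv1 uv2]]; split=> //.
have := Su j.+1 isT; have := Sv j.+1 isT; cbv zeta.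
rewrite -pred_Sn uv0 uv1 uv2 => vE.
rewrite -[RHS]vE => /addIr/addIr/addIr/mulfI -> //.
(* Each factor of the leading coefficient is the cast of a positive integer, hence nonzero in
   characteristic 0. *)
have -> : 17 * (j.+1%:R : F) ^+ 2 + 17 * j.+1%:R + 5
          = (17 * j.+1 ^ 2 + 17 * j.+1 + 5)%:R.
  by rewrite !natrD natrM natrX natrM.
have -> : 2 * (j.+1%:R : F) + 1 = (2 * j.+1 + 1)%:R by rewrite natrD natrM.
by rewrite !mulf_neq0 ?expf_neq0 // !natr_neq0.
Qed.

(** * Initial values and coordinates *)

Lemma apery_A0 : apery_A F 0 = 1.
Proof. by rewrite /apery_A big_nat1 /apery_weight !bin0; ring. Qed.

Lemma apery_A1 : apery_A F 1 = 5.
Proof.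
rewrite /apery_A /apery_weight big_nat_recr //= big_nat1 !bin0.
by rewrite !bin1; ring.
Qed.

Lemma apery_B0 : apery_B F 0 = 0.
Proof. by rewrite /apery_B big_nat1 !big_geq // addr0 mulr0. Qed.

Lemma apery_B1 : apery_B F 1 = 6.
Proof.
rewrite /apery_B /apery_weight big_nat_recr //= !big_nat1.
rewrite [\sum_(1 <= m < 1) _]big_geq // !bin0 !bin1.
by field.
Qed.

Lemma apery_val2 f : (forall n, apery_op f n = 0) ->
  f 2 = (117 * f 1 - f 0) / 8.
Proof.
move=> /(_ 0) f2; apply/eqP; rewrite -subr_eq0.
have -> : f 2 - (117 * f 1 - f 0) / 8 = apery_op f 0 / 8.
  by rewrite /apery_op /apery_poly; field.
by rewrite f2 mul0r.
Qed.

Lemma apery_val3 f : (forall n, apery_op f n = 0) ->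
  f 3 = (535%:R * f 2 - 8 * f 1) / 27.
Proof.
move=> /(_ 1) f3; apply/eqP; rewrite -subr_eq0.
have -> : f 3 - (535%:R * f 2 - 8 * f 1) / 27 = apery_op f 1 / 27.
  by rewrite /apery_op /apery_poly; field.
by rewrite f3 mul0r.
Qed.

(* A combination of the three sequences is [fun j => phi v_{j+1} v_j] for a
   symmetric bilinear form [phi], where [v_j := (A_j, B_j)].  Its terms 0, 1, 2
   give successively [phi v_1 v_0], [r := phi v_1 v_1] and [q := phi v_2 v_2],
   whence [s := phi v_0 v_0], and [v_0 = (1, 0)], [v_1 = (5, 6)]. *)
Definition coords u : F * F * F :=
  let r := (8 * u 1 + u 0) / 117 in
  let q := (27 * u 2 + 8 * u 1) / 535%:R in
  let s := 64 * q - 13689%:R * r + 234 * u 0 in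
  let z := (u 0 - 5 * s) / 6 in
  (s, (r - 25 * s - 60 * z) / 36, z).

Definition xyz_comb (a b c : F) j : F :=
  a * seq_x F j + b * seq_y F j + c * seq_z F j.

Let xyz_vals :=
  (apery_val3 apery_A_rec, apery_val3 apery_B_rec, apery_val2 apery_A_rec,
   apery_val2 apery_B_rec, apery_A0, apery_A1, apery_B0, apery_B1).

(** Recovering the coefficients gives linear independence. *)
Lemma coords_xyz_comb a b c : coords (xyz_comb a b c) = (a, b, c).
Proof.
rewrite /coords /xyz_comb /seq_x /seq_y /seq_z !xyz_vals.
by congr (_, _, _); field.
Qed.

(** Matching three initial terms gives spanning, by [solution_determined]. *)
Lemma xyz_comb_coords u j : (j < 3)%N ->
  xyz_comb (coords u).1.1 (coords u).1.2 (coords u).2 j = u j.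
Proof.
rewrite /coords /xyz_comb /seq_x /seq_y /seq_z.
by case: j => [|[|[|//]]] _; lazy beta iota zeta delta [fst snd];
  rewrite !xyz_vals; field.
Qed.

Lemma lin_comb_xyz (c : 'I_3 -> F) j :
  lin_comb c (seq_xyz F) j = xyz_comb (c 0) (c 1) (c 2) j.
Proof.
rewrite /lin_comb !big_ord_recr big_ord0 /= add0r /xyz_comb.
by congr (c _ * _ + c _ * _ + c _ * _); apply: val_inj.
Qed.

End AperyRecurrence.

Theorem theorem3p3 (F : numFieldType) :
  [/\ is_solution (seq_x F), is_solution (seq_y F) & is_solution (seq_z F)]
  /\ is_basis (@is_solution F) (seq_xyz F).
Proof.
have Ax n := apery_A_rec F n; have Bx n := apery_B_rec F n.
have half (f : nat -> F) : (forall n, apery_op f n = 0) ->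
    is_solution (fun j => f j.+1 * f j).
  move=> fP; have S2 := apery_prod_solution fP fP.
  apply: eq_solution (is_solution_lin 2^-1 0 0 S2 S2 S2) => j.
  by field.
have Sx : is_solution (seq_x F) by apply: half.
have Sy : is_solution (seq_y F) by apply: half.
have Sz : is_solution (seq_z F) by exact: apery_prod_solution.
split=> //; split.
- by case=> [[|[|[|//]]] lti]; rewrite /seq_xyz (tnth_nth (seq_x F)).
- move=> c c0.
  have : coords (lin_comb c (seq_xyz F)) = (c 0, c 1, c 2).
    by rewrite -coords_xyz_comb /coords !lin_comb_xyz.
  (* The coordinates of the null sequence are zero. *)
  rewrite /coords !c0 => -[h0 h1 h2].
  have z0 : c 0 = 0 by rewrite -h0; field.
  have z1 : c 1 = 0 by rewrite -h1; field.
  have z2 : c 2 = 0 by rewrite -h2; field.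
  case=> [[|[|[|//]]] lti]; [rewrite -z0|rewrite -z1|rewrite -z2];
    congr c; exact: val_inj.
- move=> u Su.
  exists (tnth [tuple (coords u).1.1; (coords u).1.2; (coords u).2]) => j.
  rewrite lin_comb_xyz; move: j; apply: solution_determined => //.
  + exact: is_solution_lin.
  all: by rewrite xyz_comb_coords.
Qed.
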